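(* If all of the series below converge, then $${}_{3}F_{2}\!\left[\begin{matrix}x,\,x,\,1\\ x+y,\,x+y\end{matrix}\,\Bigg|\,-1\right]=1-\frac{x^2}{(x+y)^2}\cdot{}_{3}F_{2}\!\left[\begin{matrix}x+1,\,x+1,\,1\\ x+1+y,\,x+1+y\end{matrix}\,\Bigg|\,-1\right]$$ and $${}_{3}F_{2}\!\left[\begin{matrix}x,\,x,\,1\\ x+y,\,x+y\end{matrix}\,\Bigg|\,-1\right]=\frac{2x^2+6xy+5y^2+y}{4(x+y)^2}-\frac{y(y+1)^3}{4(x+y)^2(x+y+1)^2}\cdot{}_{3}F_{2}\!\left[\begin{matrix}x,\,x,\,1\\ x+y+2,\,x+y+2\end{matrix}\,\Bigg|\,-1\right].$$
   Context: ${}_{p}F_{q}\!\left[\begin{matrix}a_1,\dots,a_p\\ b_1,\dots,b_q\end{matrix}\,\Big|\,z\right]=\sum_{k=0}^{\infty}\frac{(a_1)_k\cdots(a_p)_k}{(b_1)_k\cdots(b_q)_k}\frac{z^k}{k!}$ is the generalized hypergeometric series, where $(a)_k=a(a+1)\cdots(a+k-1)$. *)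

(* Defs.v *)
From mathcomp Require Export all_boot all_order all_algebra.
From mathcomp Require Export all_classical all_reals all_analysis.
From mathcomp Require Export complex.

Set Implicit Arguments.
Unset Strict Implicit.
Unset Printing Implicit Defensive.

Export Order.TTheory GRing.Theory Num.Theory.
Export numFieldNormedType.Exports.

Local Open Scope classical_set_scope.
Local Open Scope ring_scope.

(* (a)_k = a (a + 1) ... (a + k - 1); the library notation [n ^_ k] is the falling
   factorial, on nat only. *)
Definition pochhammer (K : numFieldType) (a : K) (k : nat) : K :=
  \prod_(i < k) (a + i%:R).

Definition hypergeometric_term (K : numFieldType) (a b : seq K) (z : K)
    (k : nat) : K :=
  (\prod_(c <- a) pochhammer c k) / (\prod_(c <- b) pochhammer c k)
    * (z ^+ k / k`!%:R).

(* Since division by zero is total here, the terms are required to be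
   well-defined (no lower parameter is 0, -1, -2, ...); convergence of the
   partial sums, not necessarily absolute, is with respect to the norm of K. *)
Definition hypergeometric_converges (K : numFieldType) (a b : seq K) (z : K)
    : Prop :=
  (forall (c : K) (k : nat), c \in b -> pochhammer c k != 0) /\
  cvgn (series (hypergeometric_term a b z)).

(* The value pFq[a; b | z]; meaningful only under [hypergeometric_converges]. *)
Definition hypergeometric (K : numFieldType) (a b : seq K) (z : K) : K :=
  limn (series (hypergeometric_term a b z)).

(* Main.v *)
(** Write [s = x + y] and [t_k = ((x)_k / (s)_k)^2]; the parameter [1] cancels
    [k!], so the three series are alternating sums of such squares.  The first
    identity splits off the term [k = 0].  For the second, put [m = s + k] and
      [r(m) = 1/2 + y / (2 m) + y (y + 1) / (4 m^2)].
    Then, with [n = m - y],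
      [r(m) + n^2 / m^2 * r(m + 1)
         = 1 + y (y + 1)^3 / (4 m^2 (m + 1)^2)],
    so that [(-1)^k t_k r(s + k)] is a telescoping certificate.  It tends to 0
    because the terms of the convergent series [\sum_k (-1)^k t_k] do and
    [r(s + k)] is bounded. *)
Require Import Defs.
From mathcomp Require Import ring.

Set Implicit Arguments.
Unset Strict Implicit.
Unset Printing Implicit Defensive.

Local Open Scope classical_set_scope.
Local Open Scope ring_scope.

Section Pochhammer.
Variable K : numFieldType.
Implicit Types (a b c z : K) (k : nat).

Lemma pochhammer0 a : pochhammer a 0 = 1.
Proof. by rewrite /pochhammer big_ord0. Qed.

Lemma pochhammerSr a k : pochhammer a k.+1 = pochhammer a k * (a + k%:R).
Proof. by rewrite /pochhammer big_ord_recr. Qed.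

Lemma pochhammerSl a k : pochhammer a k.+1 = a * pochhammer (a + 1) k.
Proof.
rewrite /pochhammer big_ord_recl addr0; congr (_ * _).
by apply: eq_bigr => i _; rewrite /= -addrA -natr1 [1 + _]addrC.
Qed.

Lemma pochhammer1 k : pochhammer (1 : K) k = k`!%:R.
Proof.
elim: k => [|k IHk]; first by rewrite pochhammer0.
by rewrite pochhammerSr IHk factS mulnC natrM -natr1 [1 + _]addrC.
Qed.

Lemma pochhammer_factor_neq0 b :
  (forall k, pochhammer b k != 0) -> forall k, b + k%:R != 0.
Proof. by move=> bP k; have := bP k.+1; rewrite pochhammerSr mulf_eq0 negb_or => /andP[]. Qed.

Lemma hypergeometric_term_sqr a b z k :
  hypergeometric_term [:: a; a; 1] [:: b; b] z k
    = (pochhammer a k / pochhammer b k) ^+ 2 * z ^+ k.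
Proof.
rewrite /hypergeometric_term !big_cons !big_nil pochhammer1 !mulr1.
have k0 : k`!%:R != 0 :> K by rewrite pnatr_eq0 -lt0n fact_gt0.
by rewrite invfM; move: (pochhammer b k)^-1 => B; field.
Qed.

(** Both sides are [(a)_(k+2)], with either the first two or the last two factors split off. *)
Lemma pochhammer_shift2 a k :
  a * (a + 1) * pochhammer (a + 2) k
    = pochhammer a k * (a + k%:R) * (a + k%:R + 1).
Proof.
have -> : a + 2 = a + 1 + 1 by ring.
by rewrite -mulrA -!pochhammerSl !pochhammerSr -natr1 addrA.
Qed.

(** The coefficients of [m^-1] are forced: in [certificateE], expanded at infinity, they cancel
    everything on the left up to order [m^-2] except the constant [1]. *)
Definition certificate y m : K :=
  2^-1 + y / 2 * m^-1 + y * (y + 1) / 4 * m^-1 ^+ 2.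

Lemma certificateE y m : m != 0 -> m + 1 != 0 ->
  certificate y m + (m - y) ^+ 2 / m ^+ 2 * certificate y (m + 1)
    = 1 + y * (y + 1) ^+ 3 / (4 * m ^+ 2 * (m + 1) ^+ 2).
Proof. by move=> m0 m1; rewrite /certificate; field; rewrite m0 m1. Qed.

(** All powers of [m^-1] have norm at most [1], so the sum of the norms of the coefficients is a
    bound; the coefficient [1/2] makes it positive. *)
Lemma certificate_bounded y : exists2 M : K, 0 < M &
  forall m, 1 <= `|m| -> `|certificate y m| <= M.
Proof.
exists (`|2^-1| + `|y / 2| + `|y * (y + 1) / 4|).
  by rewrite -addrA ltr_pwDl ?addr_ge0 // normr_gt0 invr_neq0.
move=> m m1; have mV : `|m^-1| <= 1 by rewrite normfV invf_le1 // (lt_le_trans _ m1).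
rewrite (le_trans (ler_normD _ _))// lerD//.
  by rewrite (le_trans (ler_normD _ _))// lerD// normrM ler_piMr.
by rewrite normrM ler_piMr// normrX exprn_ile1.
Qed.

End Pochhammer.

Section Convergence.
Variable K : numFieldType.

Lemma cvg0_mul_bounded (u v : nat -> K) (M : K) : 0 < M ->
  u n @[n --> \oo] --> 0 -> (\forall n \near \oo, `|v n| <= M) ->
  u n * v n @[n --> \oo] --> 0.
Proof.
move=> M0 /cvgr0Pnorm_lt u0 vM; apply/cvgr0Pnorm_lt => e e0.
have {}u0 := u0 _ (divr_gt0 e0 M0).
near=> n.
have un : `|u n| < e / M by near: n.
have vn : `|v n| <= M by near: n.
rewrite normrM (le_lt_trans (ler_wpM2l _ vn))//.
by rewrite -ltr_pdivlMr.
Unshelve. all: by end_near. Qed.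

Lemma hypergeometric_contiguous (x s : K) :
  hypergeometric_converges [:: x; x; 1] [:: s; s] (- 1) ->
  hypergeometric_converges [:: x + 1; x + 1; 1] [:: s + 1; s + 1] (- 1) ->
  hypergeometric [:: x; x; 1] [:: s; s] (- 1)
    = 1 - x ^+ 2 / s ^+ 2
          * hypergeometric [:: x + 1; x + 1; 1] [:: s + 1; s + 1] (- 1).
Proof.
move=> [_ cu] [_ cv]; rewrite /hypergeometric.
set u := hypergeometric_term _ _ _ in cu *.
set v := hypergeometric_term _ _ _ in cv *.
apply: (@cvg_lim K); first exact: norm_hausdorff.
(* The first [n + 1] terms of [u] are the term [1] and, since [(x)_(k+1) = x (x+1)_k], the first [n]
   terms of [v] scaled by [- x^2 / s^2]. *)
rewrite -cvg_shiftS.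
have -> : [sequence series u n.+1]_n = (fun n => 1 - x ^+ 2 / s ^+ 2 * series v n).
  apply/funext => n; rewrite !seriesEnat /= big_nat_recl//; congr (_ + _).
    by rewrite /u hypergeometric_term_sqr !pochhammer0 divr1 !expr1n expr0 mulr1.
  rewrite mulr_sumr -sumrN; apply: eq_bigr => k _.
  rewrite /u /v !hypergeometric_term_sqr !pochhammerSl invfM
    [(-1) ^+ k.+1]exprS -[(s ^+ 2)^-1]exprVn.
  by ring.
by apply: cvgB; [exact: cvg_cst | apply: cvgMl_tmp].
Qed.

(** The growth of [s + n] is a hypothesis because a general [K] need not be archimedean. *)
Lemma hypergeometric_lower_shift2 (x y : K) : let s := x + y in
  (\forall n \near \oo, 1 <= `|s + n%:R|) ->
  hypergeometric_converges [:: x; x; 1] [:: s; s] (- 1) ->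
  hypergeometric_converges [:: x; x; 1] [:: s + 2; s + 2] (- 1) ->
  hypergeometric [:: x; x; 1] [:: s; s] (- 1)
    = certificate y s
      - y * (y + 1) ^+ 3 / (4 * s ^+ 2 * (s + 1) ^+ 2)
          * hypergeometric [:: x; x; 1] [:: s + 2; s + 2] (- 1).
Proof.
move=> s s_large [sP cu] [sP2 cv].
have {}sP k : pochhammer s k != 0 by apply: sP; rewrite mem_head.
have {}sP2 k : pochhammer (s + 2) k != 0 by apply: sP2; rewrite mem_head.
have sk := pochhammer_factor_neq0 sP.
have s0 : s != 0 by have := sk 0%N; rewrite addr0.
have s1 : s + 1 != 0 := sk 1%N.
rewrite /hypergeometric.
set u := hypergeometric_term _ _ _ in cu *.
set v := hypergeometric_term _ _ _ in cv *.
set c := y * _ / _.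
pose G k : K := u k * certificate y (s + k%:R).
(* By [pochhammer_shift2], [c * v k] is [u k] times the excess over [1] in [certificateE] at
   [m = s + k], while [u k.+1 = - u k * ((x + k) / (s + k))^2]. *)
have uv k : u k + c * v k = G k - G k.+1.
  rewrite /G /u /v !hypergeometric_term_sqr !pochhammerSr.
  have -> : pochhammer (s + 2) k
      = pochhammer s k * (s + k%:R) * (s + k%:R + 1) / (s * (s + 1)).
    by rewrite -pochhammer_shift2 mulrC mulKf // mulf_neq0.
  have := sP k; have := sk k; have := sk k.+1; rewrite -natr1 addrA => m1 m0 p0.
  (* Eliminating [r(m)] leaves [r(m + 1)] as the only value of the certificate, which can then be
     generalized to a free variable. *)
  have -> : certificate y (s + k%:R) = 1
      + y * (y + 1) ^+ 3 / (4 * (s + k%:R) ^+ 2 * (s + k%:R + 1) ^+ 2)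
      - (s + k%:R - y) ^+ 2 / (s + k%:R) ^+ 2 * certificate y (s + k%:R + 1).
    by rewrite -certificateE // addrK.
  have -> : x + k%:R = s + k%:R - y by rewrite /s; ring.
  rewrite [(-1) ^+ k.+1]exprS /c; move: (certificate _ _) => r; move: (_ ^+ k) => e.
  by field; rewrite s0 s1 m0 m1 p0.
have G0 : G n @[n --> \oo] --> 0.
  have [M M0 rM] := certificate_bounded y.
  apply: (cvg0_mul_bounded M0); first exact: (@cvg_series_cvg_0 K K^o).
  by apply: filterS s_large => n; apply: rM.
have G00 : G 0%N = certificate y s.
  by rewrite /G /u hypergeometric_term_sqr !pochhammer0 divr1 expr1n expr0 !mul1r addr0.
apply: (@cvg_lim K); first exact: norm_hausdorff.
(* Summing [uv] over [k < n] telescopes to [G 0 - G n]. *)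
have -> : series u = (fun n => certificate y s - G n - c * series v n).
  apply/funext => n; apply/eqP; rewrite eq_sym subr_eq !seriesEnat /= mulr_sumr -big_split /=.
  under eq_bigr do rewrite uv -opprB.
  by rewrite sumrN telescope_sumr // opprB G00.
apply: cvgB; last by apply: cvgMl_tmp.
by rewrite -[X in _ --> X]subr0; apply: cvgB => //; exact: cvg_cst.
Qed.

Lemma alternating_3F2_recurrences (x y : K)
  (s_large : \forall n \near \oo, 1 <= `|x + y + n%:R|)
  (h0 : hypergeometric_converges [:: x; x; 1] [:: x + y; x + y] (- 1))
  (h1 : hypergeometric_converges
          [:: x + 1; x + 1; 1] [:: x + 1 + y; x + 1 + y] (- 1))
  (h2 : hypergeometric_converges
          [:: x; x; 1] [:: x + y + 2; x + y + 2] (- 1)) :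
  hypergeometric [:: x; x; 1] [:: x + y; x + y] (- 1)
    = 1 - x ^+ 2 / (x + y) ^+ 2
          * hypergeometric [:: x + 1; x + 1; 1] [:: x + 1 + y; x + 1 + y] (- 1)
  /\
  hypergeometric [:: x; x; 1] [:: x + y; x + y] (- 1)
    = (2 * x ^+ 2 + 6 * x * y + 5 * y ^+ 2 + y) / (4 * (x + y) ^+ 2)
      - y * (y + 1) ^+ 3 / (4 * (x + y) ^+ 2 * (x + y + 1) ^+ 2)
          * hypergeometric [:: x; x; 1] [:: x + y + 2; x + y + 2] (- 1).
Proof.
have sE : x + 1 + y = x + y + 1 by ring.
split; first by rewrite sE in h1 *; exact: hypergeometric_contiguous.
rewrite hypergeometric_lower_shift2//.
congr (_ - _).
(* [(s)_1 = s] is nonzero by [h0]; then [r(s)] has numerator [2 s^2 + 2 y s + y (y + 1)] over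
   [4 s^2], which expands to the stated one. *)
have s0 : x + y != 0.
  by have := h0.1 (x + y) 1%N (mem_head _ _); rewrite pochhammerSl pochhammer0 mulr1.
by rewrite /certificate; field; rewrite s0.
Qed.

End Convergence.

(** The norm of [s] is an embedded real [r], and as soon as [n >= r + 1], the reverse triangle
    inequality gives [|s + n| >= n - r >= 1]. *)
Lemma complex_shift_large (R : realType) (s : R[i]) :
  \forall n \near \oo, 1 <= `|s + n%:R|.
Proof.
have [r sr] : exists r : R, `|s| = r%:C%C by rewrite normc_def; eexists.
near=> n.
have nr : r + 1 <= n%:R by near: n; exact: nbhs_infty_ger.
rewrite addrC (le_trans _ (lerB_normD _ _))// normr_nat sr lerBrDr.
by rewrite -[1](rmorph1 (real_complex R)) -rmorphD -(rmorph_nat (real_complex R)) lecR addrC.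
Unshelve. all: by end_near. Qed.

Theorem theorem9 (R : realType) (x y : R[i])
  (h0 : hypergeometric_converges [:: x; x; 1] [:: x + y; x + y] (- 1))
  (h1 : hypergeometric_converges
          [:: x + 1; x + 1; 1] [:: x + 1 + y; x + 1 + y] (- 1))
  (h2 : hypergeometric_converges
          [:: x; x; 1] [:: x + y + 2; x + y + 2] (- 1)) :
  hypergeometric [:: x; x; 1] [:: x + y; x + y] (- 1)
    = 1 - x ^+ 2 / (x + y) ^+ 2
          * hypergeometric [:: x + 1; x + 1; 1] [:: x + 1 + y; x + 1 + y] (- 1)
  /\
  hypergeometric [:: x; x; 1] [:: x + y; x + y] (- 1)
    = (2 * x ^+ 2 + 6 * x * y + 5 * y ^+ 2 + y) / (4 * (x + y) ^+ 2)
      - y * (y + 1) ^+ 3 / (4 * (x + y) ^+ 2 * (x + y + 1) ^+ 2)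
          * hypergeometric [:: x; x; 1] [:: x + y + 2; x + y + 2] (- 1).
Proof. exact: (alternating_3F2_recurrences (complex_shift_large _) h0 h1 h2). Qed.
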